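(* Let $\{w^k\}_{k\ge 0}$ and $\{\tilde w^k\}_{k\ge 0}$, $w^k=(x^k;y^k)$, $\tilde w^k=(\tilde x^k;\tilde y^k)$, be the sequences generated by the adaptive primal dual hybrid gradient algorithm (described in the context), and suppose that the relaxed condition $$\frac1r\|A^T(y^k-\tilde y^k)\|^2\le \nu\, s_k\|y^k-\tilde y^k\|^2,\qquad \nu\in(0,1),$$ holds for all $k\ge 0$. Then the sequence $\{w^k\}$ converges to some $w^\infty\in\Omega^*$.
   Context: Problem. Consider $\min_{x\in\mathcal X}\max_{y\in\mathcal Y}\Phi(x,y):=\theta_1(x)-y^TAx-\theta_2(y)$, where $\theta_1:\mathbb R^n\to\mathbb R$ and $\theta_2:\mathbb R^m\to\mathbb R$ are (finite-valued) convex, not necessarily smooth, functions, $\mathcal X\subseteq\mathbb R^n$ and $\mathcal Y\subseteq\mathbb R^m$ are closed convex sets, and $A\in\mathbb R^{m\times n}$ is a nonzero matrix. The solution (saddle point) set is assumed nonempty. Put $\Omega=\mathcal X\times\mathcal Y$, $w=(x;y)$, $\theta(w)=\theta_1(x)+\theta_2(y)$, $F(w)=(-A^Ty;\,Ax)$. $\Omega^*$ denotes the set of $w^*\in\Omega$ with $\theta(w)-\theta(w^* )+(w-w^* )^TF(w^* )\ge 0$ for all $w\in\Omega$; equivalently, the set of saddle points of $\Phi$ on $\mathcal X\times\mathcal Y$. Notation. $\rho(\cdot)$ is the largest eigenvalue of a symmetric positive semidefinite matrix; $\rho_{\mathrm{average}}(A^TA)=\frac1n\mathrm{Trace}(A^TA)$,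 $\rho_{\mathrm{average}}(AA^T)=\frac1m\mathrm{Trace}(AA^T)$. For symmetric positive definite $H$, $\|w\|_H^2=w^THw$. Parameters. $r=\tau\rho_{\mathrm{average}}(A^TA)$ with $\tau\in[1/5,5]$; $s_0=\frac{3}{2r}\rho_{\mathrm{average}}(AA^T)$; $s_a=\frac1r\kappa\rho_{\mathrm{average}}(AA^T)$ with $\kappa\in[1/10,10]$; threshold $s_{\min}=\sqrt{\rho_{\mathrm{average}}(AA^T)/\rho(AA^T)}\;s_a$; $\gamma\in(0,2)$, $\nu\in(0,1)$, $\mu\in(0,\nu)$, $\theta>1/\nu$ (default values $\gamma=1$, $\theta=1.2$, $\mu=0.5$, $\nu=0.9$; this scalar $\theta$ is unrelated to the function $\theta(w)$). Matrices. For $s_k>0$, $$Q_k^{PD}=\begin{pmatrix} rI_n&A^T\\0&s_kI_m\end{pmatrix},\quad H^{PD}=\begin{pmatrix} rI_n&0\\0&s_aI_m\end{pmatrix},\quad M_k^{PD}=\begin{pmatrix}I_n&\frac1rA^T\\0&\frac{s_k}{s_a}I_m\end{pmatrix}.$$ Adaptive primal dual hybrid gradient algorithm. Start from $w^0=(x^0;y^0)\in\mathbb R^n\times\mathbb R^m$. For $k=0,1,2,\dots$: (1) $\tilde x^k\in\arg\min\{\Phi(x,y^k)+\frac r2\|x-x^k\|^2: x\in\mathcal X\}$. (2) $\tilde y^k\in\arg\max\{\Phi(\tilde x^k,y)-\frac{s_k}2\|y-y^k\|^2: y\in\mathcal Y\}$; compute $t=\big(\frac1r\|A^T(y^k-\tilde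 y^k)\|^2\big)/\big(s_k\|y^k-\tilde y^k\|^2\big)$ (with $t=0$ if $\tilde y^k=y^k$). While $t>\nu$: replace $s_k$ by $s_k\cdot t\cdot\theta$, recompute $\tilde y^k$ with the new $s_k$, and recompute $t$. From now on $s_k$ denotes the final value in iteration $k$. (3) $w^{k+1}=w^k-\gamma\alpha_k^*M_k^{PD}(w^k-\tilde w^k)$ with $\alpha_k^*=\dfrac{(w^k-\tilde w^k)^TQ_k^{PD}(w^k-\tilde w^k)}{\|M_k^{PD}(w^k-\tilde w^k)\|_{H^{PD}}^2}$. (4) If $t\le\mu$ and $s_k>s_{\min}$, set $s_{k+1}=\max\{\frac23s_k,\,s_{\min}\}$; otherwise set $s_{k+1}=s_k$ (this is the initial value of the parameter for iteration $k+1$). The stopping criterion is ignored, so the sequences are infinite, and it is assumed throughout that $w^k\ne\tilde w^k$ for all $k$ (otherwise $w^k$ is already a solution). *)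

(* Defs.v *)
From HB Require Import structures.
From mathcomp Require Import all_boot all_order all_algebra.
From mathcomp Require Import all_classical all_reals all_analysis.

Set Implicit Arguments.
Unset Strict Implicit.
Unset Printing Implicit Defensive.

Import Order.TTheory GRing.Theory Num.Theory.
Import numFieldNormedType.Exports.

Local Open Scope classical_set_scope.
Local Open Scope ring_scope.

Section LinearAlgebra.
Context {R : realType} {p : nat}.

Definition dot (u v : 'cV[R]_p) : R := (u^T *m v) 0 0.

(* The squared norms are Euclidean; the library norm on matrices is the
   max norm (it induces the same topology). *)
Definition sqnorm (v : 'cV[R]_p) : R := dot v v.

Definition sqnormH (H : 'M[R]_p) (v : 'cV[R]_p) : R := (v^T *m H *m v) 0 0.

(* For a symmetric S of positive size the set below is finite and nonempty, so
   its supremum is the largest eigenvalue. *)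
Definition rho (S : 'M[R]_p) : R := sup [set a : R | eigenvalue S a].

Definition rho_average (S : 'M[R]_p) : R := p%:R^-1 * \tr S.

Definition is_convex_set (C : set 'cV[R]_p) : Prop :=
  convex_set (C : set (convex_lmodType 'cV[R]_p)).

Definition is_convex_function (f : 'cV[R]_p -> R) : Prop :=
  convex_function (setT : set (convex_lmodType 'cV[R]_p)) f.

Definition argmin (C : set 'cV[R]_p) (f : 'cV[R]_p -> R) : set 'cV[R]_p :=
  [set x | C x /\ forall z, C z -> f x <= f z].

Definition argmax (C : set 'cV[R]_p) (f : 'cV[R]_p -> R) : set 'cV[R]_p :=
  [set x | C x /\ forall z, C z -> f z <= f x].

End LinearAlgebra.

Section Problem.
Context {R : realType} {n m : nat}.
Variables (A : 'M[R]_(m, n)).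
Variables (theta1 : 'cV[R]_n -> R) (theta2 : 'cV[R]_m -> R).
Variables (X : set 'cV[R]_n) (Y : set 'cV[R]_m).

Definition Phi (x : 'cV[R]_n) (y : 'cV[R]_m) : R :=
  theta1 x - (y^T *m A *m x) 0 0 - theta2 y.

Definition saddle_points : set ('cV[R]_n * 'cV[R]_m) :=
  [set z | [/\ X z.1, Y z.2 &
    forall x y, X x -> Y y ->
      Phi z.1 y <= Phi z.1 z.2 /\ Phi z.1 z.2 <= Phi x z.2]].

Definition Omega : set 'cV[R]_(n + m) :=
  [set w | X (usubmx w) /\ Y (dsubmx w)].

Definition thetaW (w : 'cV[R]_(n + m)) : R :=
  theta1 (usubmx w) + theta2 (dsubmx w).

Definition F (w : 'cV[R]_(n + m)) : 'cV[R]_(n + m) :=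
  col_mx (- (A^T *m dsubmx w)) (A *m usubmx w).

Definition Omega_star : set 'cV[R]_(n + m) :=
  [set ws | Omega ws /\ forall w, Omega w ->
    0 <= thetaW w - thetaW ws + dot (w - ws) (F ws)].

Definition QPD (r s : R) : 'M[R]_(n + m) :=
  block_mx r%:M A^T 0 s%:M.

Definition HPD (r sa : R) : 'M[R]_(n + m) :=
  block_mx r%:M 0 0 sa%:M.

Definition MPD (r sa s : R) : 'M[R]_(n + m) :=
  block_mx 1%:M (r^-1 *: A^T) 0 (s / sa)%:M.

Definition x_step (r : R) (xk : 'cV[R]_n) (yk : 'cV[R]_m) : set 'cV[R]_n :=
  argmin X (fun x => Phi x yk + r / 2 * sqnorm (x - xk)).

Definition y_step (s : R) (xt : 'cV[R]_n) (yk : 'cV[R]_m) : set 'cV[R]_m :=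
  argmax Y (fun y => Phi xt y - s / 2 * sqnorm (y - yk)).

Definition ratio (r s : R) (y yt : 'cV[R]_m) : R :=
  if yt == y then 0
  else (r^-1 * sqnorm (A^T *m (y - yt))) / (s * sqnorm (y - yt)).

(* [backtrack r nu theta xt yk s s' yt]: the dual while loop, entered with
   parameter s, stops with parameter s' and trial point yt.  Being inductive,
   it only describes executions of the loop that stop. *)
Inductive backtrack (r nu theta : R) (xt : 'cV[R]_n) (yk : 'cV[R]_m) :
    R -> R -> 'cV[R]_m -> Prop :=
| backtrack_stop s yt :
    y_step s xt yk yt -> ratio r s yk yt <= nu ->
    backtrack r nu theta xt yk s s yt
| backtrack_step s yt s' yt' :
    y_step s xt yk yt -> nu < ratio r s yk yt ->
    backtrack r nu theta xt yk (s * ratio r s yk yt * theta) s' yt' ->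
    backtrack r nu theta xt yk s s' yt'.

Definition alpha_star (r sa s : R) (w wt : 'cV[R]_(n + m)) : R :=
  dot (w - wt) (QPD r s *m (w - wt))
    / sqnormH (HPD r sa) (MPD r sa s *m (w - wt)).

(* Iteration k enters the dual while loop with the parameter [sinit k] and
   leaves it with [s k]. *)
Record apdhg (r s0 sa smin gamma nu mu theta : R)
    (w wt : nat -> 'cV[R]_(n + m)) (sinit s : nat -> R) : Prop := {
  apdhg_init : sinit 0%N = s0;
  apdhg_x : forall k,
    x_step r (usubmx (w k)) (dsubmx (w k)) (usubmx (wt k));
  apdhg_y : forall k,
    backtrack r nu theta (usubmx (wt k)) (dsubmx (w k))
      (sinit k) (s k) (dsubmx (wt k));
  apdhg_w : forall k,
    w k.+1 = w k - (gamma * alpha_star r sa (s k) (w k) (wt k))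
                     *: (MPD r sa (s k) *m (w k - wt k));
  apdhg_s : forall k,
    sinit k.+1 =
      if (ratio r (s k) (dsubmx (w k)) (dsubmx (wt k)) <= mu) && (smin < s k)
      then Num.max (2 / 3 * s k) smin
      else s k
}.

End Problem.

(* Main.v *)
Require Import Defs.
From HB Require Import structures.
From mathcomp Require Import all_boot all_order all_algebra.
From mathcomp Require Import all_classical all_reals all_analysis.
From mathcomp Require Import ring lra.

Set Implicit Arguments.
Unset Strict Implicit.
Unset Printing Implicit Defensive.

Import Order.TTheory GRing.Theory Num.Theory.
Import numFieldNormedType.Exports.

Local Open Scope classical_set_scope.
Local Open Scope ring_scope.

(** The method is a contraction-type scheme for the variational inequality that
    characterises saddle points, and the proof is a Fejer-monotonicity argument.

    Write d = w^k - wt^k, let Q, H, M be the three matrices of the method (so that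
    H M = Q), phi = d^T Q d and N = |M d|_H^2.  The optimality conditions of the two
    proximal subproblems, tested at a solution ws, combine with the inequality
    defining ws into (wt^k - ws)^T Q d >= 0: the coupling terms cancel because F is
    skew-symmetric ([trial_cross_ge0]).  Hence a step of length b along - M d changes
    |w^k - ws|_H^2 by at most - 2 b phi + b^2 N, and b = gamma phi / N with
    0 < gamma < 2 makes this at most - gamma (2 - gamma) phi^2 / N.  The relaxed
    condition gives phi >= T / 2 for T = r |dx|^2 + s_k |dy|^2, and N is at most a
    multiple of T as long as s_k is bounded above; so the decrease is at least a
    fixed multiple of T ([relaxed_step_decrease]).

    The metric H does not depend on k; the variable step s_k only has to stay
    between two positive constants ([apdhg_step_bounds]).  The upper bound holds
    because an enlarged step is at most theta |A|_F^2 / r, in the Frobenius norm.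
    The lower bound is min(s0, smin), and smin > 0 amounts to rho (A A^T) > 0, which
    is shown by maximising |A^T v| on the unit sphere ([rho_gram_gt0]).

    Since the decreases are summable, w^k - wt^k tends to 0.  The iterates are
    bounded, and along a convergent subsequence the optimality conditions of the
    subproblems pass to the limit because finite convex functions on a
    finite-dimensional space are continuous ([convex_continuous]); so limit points
    are solutions ([limit_point_Omega_star]).  A Fejer monotone sequence all of
    whose limit points are solutions converges to one of them ([fejer_cvg]). *)

(** * Euclidean inner product on column vectors *)

Section Dot.
Context {R : realType}.
Implicit Types (p q : nat).

Lemma dotE p (u v : 'cV[R]_p) : dot u v = \sum_i u i 0 * v i 0.
Proof. by rewrite /dot mxE; apply: eq_bigr => i _; rewrite mxE. Qed.

Lemma dotC p (u v : 'cV[R]_p) : dot u v = dot v u.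
Proof. by rewrite !dotE; apply: eq_bigr => i _; rewrite mulrC. Qed.

Lemma dotDl p (u v w : 'cV[R]_p) : dot (u + v) w = dot u w + dot v w.
Proof. by rewrite /dot linearD mulmxDl mxE. Qed.

Lemma dotDr p (u v w : 'cV[R]_p) : dot w (u + v) = dot w u + dot w v.
Proof. by rewrite dotC dotDl !(dotC w). Qed.

Lemma dotZl p (a : R) (u v : 'cV[R]_p) : dot (a *: u) v = a * dot u v.
Proof. by rewrite /dot linearZ -scalemxAl mxE. Qed.

Lemma dotZr p (a : R) (u v : 'cV[R]_p) : dot u (a *: v) = a * dot u v.
Proof. by rewrite dotC dotZl dotC. Qed.

Lemma dotNl p (u v : 'cV[R]_p) : dot (- u) v = - dot u v.
Proof. by rewrite -scaleN1r dotZl mulN1r. Qed.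

Lemma dotNr p (u v : 'cV[R]_p) : dot u (- v) = - dot u v.
Proof. by rewrite dotC dotNl dotC. Qed.

Definition dot_bilinear := (@dotDl, @dotDr, @dotZl, @dotZr, @dotNl, @dotNr).

Lemma dot0l p (v : 'cV[R]_p) : dot 0 v = 0.
Proof. by rewrite -(scale0r v) dotZl mul0r. Qed.

Lemma dot_mulmxr p q (B : 'M[R]_(p, q)) (u : 'cV[R]_p) (v : 'cV[R]_q) :
  dot u (B *m v) = dot (B^T *m u) v.
Proof. by rewrite /dot trmx_mul trmxK mulmxA. Qed.

Lemma dot_col p q (u u' : 'cV[R]_p) (v v' : 'cV[R]_q) :
  dot (col_mx u v) (col_mx u' v') = dot u u' + dot v v'.
Proof. by rewrite /dot tr_col_mx mul_row_col mxE. Qed.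

Lemma sqnormE p (u : 'cV[R]_p) : sqnorm u = \sum_i u i 0 ^+ 2.
Proof. by rewrite /sqnorm dotE; apply: eq_bigr => i _; rewrite expr2. Qed.

Lemma sqnorm_ge0 p (u : 'cV[R]_p) : 0 <= sqnorm u.
Proof. by rewrite sqnormE sumr_ge0// => i _; rewrite sqr_ge0. Qed.

Lemma sqnorm0 p : sqnorm (0 : 'cV[R]_p) = 0.
Proof. by rewrite /sqnorm dot0l. Qed.

Lemma entry_le_sqnorm p (u : 'cV[R]_p) i : u i 0 ^+ 2 <= sqnorm u.
Proof.
by rewrite sqnormE (bigD1 i)//= lerDl sumr_ge0// => j _; rewrite sqr_ge0.
Qed.

Lemma sqnorm_gt0 p (u : 'cV[R]_p) : (0 < sqnorm u) = (u != 0).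
Proof.
apply/idP/idP => [|/cV0Pn[i ui]].
  by apply: contraTneq => ->; rewrite sqnorm0 ltxx.
by rewrite (lt_le_trans _ (entry_le_sqnorm _ i))// exprn_even_gt0.
Qed.

Lemma sqnormD p (u v : 'cV[R]_p) :
  sqnorm (u + v) = sqnorm u + 2 * dot u v + sqnorm v.
Proof. by rewrite /sqnorm !dot_bilinear (dotC v u); ring. Qed.

Lemma sqnormZ p (a : R) (u : 'cV[R]_p) : sqnorm (a *: u) = a ^+ 2 * sqnorm u.
Proof. by rewrite /sqnorm !dot_bilinear; ring. Qed.

Lemma sqnormN p (u : 'cV[R]_p) : sqnorm (- u) = sqnorm u.
Proof. by rewrite /sqnorm !dot_bilinear opprK. Qed.

Lemma sqnormB p (u v : 'cV[R]_p) :
  sqnorm (u - v) = sqnorm u - 2 * dot u v + sqnorm v.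
Proof. by rewrite sqnormD sqnormN dotNr mulrN. Qed.

Lemma sqnorm_col p q (u : 'cV[R]_p) (v : 'cV[R]_q) :
  sqnorm (col_mx u v) = sqnorm u + sqnorm v.
Proof. exact: dot_col. Qed.

Lemma cauchy_schwarz p (u v : 'cV[R]_p) : dot u v ^+ 2 <= sqnorm u * sqnorm v.
Proof.
have [->|v0] := eqVneq v 0; first by rewrite dotC dot0l expr0n mulr_ge0 ?sqnorm_ge0.
have vp : 0 < sqnorm v by rewrite sqnorm_gt0.
have := sqnorm_ge0 (sqnorm v *: u - dot u v *: v).
rewrite sqnormB !sqnormZ dotZl dotZr.
rewrite (_ : _ + _ = sqnorm v * (sqnorm u * sqnorm v - dot u v ^+ 2)); last by ring.
by rewrite pmulr_rge0// subr_ge0.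
Qed.

(** The squared Frobenius norm of [B] is a bound for its squared operator
    norm, by Cauchy-Schwarz on each row. *)
Lemma sqnorm_mulmx_le p q (B : 'M[R]_(p, q)) (u : 'cV[R]_q) :
  sqnorm (B *m u) <= \tr (B *m B^T) * sqnorm u.
Proof.
rewrite sqnormE /mxtrace mulr_suml; apply: ler_sum => i _.
have -> : (B *m u) i 0 = dot (row i B)^T u.
  by rewrite dotE mxE; apply: eq_bigr => j _; rewrite !mxE.
rewrite (_ : (B *m B^T) i i = sqnorm (row i B)^T) ?cauchy_schwarz//.
by rewrite sqnormE !mxE; apply: eq_bigr => j _; rewrite !mxE expr2.
Qed.

Lemma trace_mulmx_tr_ge0 p q (B : 'M[R]_(p, q)) : 0 <= \tr (B *m B^T).
Proof.
rewrite /mxtrace sumr_ge0// => i _; rewrite mxE sumr_ge0// => j _.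
by rewrite mxE -expr2 sqr_ge0.
Qed.

Lemma trace_mulmx_tr_gt0 p q (B : 'M[R]_(p, q)) : B != 0 -> 0 < \tr (B *m B^T).
Proof.
move=> B0; rewrite lt0r trace_mulmx_tr_ge0 andbT.
apply: contraNneq B0 => tr0; apply/eqP/matrixP => i j.
have : sqnorm (B *m delta_mx j 0) <= 0.
  by rewrite (le_trans (sqnorm_mulmx_le _ _))// tr0 mul0r.
move/(le_trans (entry_le_sqnorm _ i)).
rewrite -colE !mxE => h; apply/eqP; rewrite -sqrf_eq0.
by rewrite eq_le h sqr_ge0.
Qed.

End Dot.

(** * Convergence measured by the Euclidean norm *)

Section Convergence.
Context {R : realType}.

Lemma cvg_dot p {T : Type} (G : set_system T) {FG : Filter G}
    (u v : T -> 'cV[R]_p) (a b : 'cV[R]_p) :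
  u @ G --> a -> v @ G --> b -> (fun k => dot (u k) (v k)) @ G --> dot a b.
Proof.
move=> ua vb; under eq_fun do rewrite dotE; rewrite dotE.
apply: cvg_big; first exact: add_continuous.
move=> i _; apply: cvgM.
  exact: (continuous_cvg _ (@coord_continuous _ _ _ i 0 a)).
exact: (continuous_cvg _ (@coord_continuous _ _ _ i 0 b)).
Qed.

(** The topology of matrices is that of the max norm, so the Euclidean norm has
    to be related to it once and for all. *)
Lemma cvg_sqnormP p {T : Type} (G : set_system T) {FG : Filter G}
    (u : T -> 'cV[R]_p) (a : 'cV[R]_p) :
  u @ G --> a <-> (fun k => sqnorm (u k - a)) @ G --> (0 : R).
Proof.
split=> [ua|/cvgrPdist_lt na].
  have ca : (fun=> a : 'cV[R]_p) @ G --> a by exact: cvg_cst.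
  have d0 : (fun k => u k - a) @ G --> (0 : 'cV[R]_p).
    by rewrite -(subrr a); exact: cvgB.
  by rewrite -(@sqnorm0 R p); apply: cvg_dot.
apply/cvg_ballP => e e0.
have := na (e ^+ 2) (exprn_gt0 2 e0); apply: filterS => k.
rewrite sub0r normrN ger0_norm ?sqnorm_ge0// => h; split=> // i j.
rewrite /ball /= (ord1 j).
have := le_lt_trans (entry_le_sqnorm (u k - a) i) h.
rewrite !mxE -normrN opprB -[X in X < _]real_normK ?num_real//.
by rewrite ltr_pXn2r// ?nnegrE ?ltW.
Qed.

Lemma cvg_sqnorm_le p q {T : Type} (G : set_system T) {FG : Filter G} (K : R)
    (u : T -> 'cV[R]_p) (a : 'cV[R]_p) (v : T -> 'cV[R]_q) (b : 'cV[R]_q) :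
  (forall k, sqnorm (v k - b) <= K * sqnorm (u k - a)) ->
  u @ G --> a -> v @ G --> b.
Proof.
move=> vu /cvg_sqnormP ua; apply/cvg_sqnormP.
apply: (@squeeze_cvgr _ _ _ _ (fun=> 0) (fun k => K * sqnorm (u k - a))).
- by apply: nearW => k; rewrite sqnorm_ge0 vu.
- exact: cvg_cst.
- by rewrite -(mulr0 K); apply: cvgM => //; exact: cvg_cst.
Qed.

Lemma cvg_mulmx p q {T : Type} (G : set_system T) {FG : Filter G}
    (B : 'M[R]_(q, p)) (u : T -> 'cV[R]_p) (a : 'cV[R]_p) :
  u @ G --> a -> (fun k => B *m u k) @ G --> B *m a.
Proof.
apply: (@cvg_sqnorm_le _ _ _ _ _ (\tr (B *m B^T))) => k.
by rewrite -mulmxBr sqnorm_mulmx_le.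
Qed.

Lemma sqnorm_submx p q (v : 'cV[R]_(p + q)) :
  sqnorm v = sqnorm (usubmx v) + sqnorm (dsubmx v).
Proof. by rewrite -[in LHS](vsubmxK v) sqnorm_col. Qed.

Lemma cvg_usubmx p q {T : Type} (G : set_system T) {FG : Filter G}
    (u : T -> 'cV[R]_(p + q)) (a : 'cV[R]_(p + q)) :
  u @ G --> a -> (fun k => usubmx (u k)) @ G --> usubmx a.
Proof.
apply: (@cvg_sqnorm_le _ _ _ _ _ 1) => k.
by rewrite mul1r -linearB (sqnorm_submx (_ - _)) lerDl sqnorm_ge0.
Qed.

Lemma cvg_dsubmx p q {T : Type} (G : set_system T) {FG : Filter G}
    (u : T -> 'cV[R]_(p + q)) (a : 'cV[R]_(p + q)) :
  u @ G --> a -> (fun k => dsubmx (u k)) @ G --> dsubmx a.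
Proof.
apply: (@cvg_sqnorm_le _ _ _ _ _ 1) => k.
by rewrite mul1r -linearB (sqnorm_submx (_ - _)) lerDr sqnorm_ge0.
Qed.

Lemma tr_continuous p q : continuous (@trmx R p q).
Proof.
move=> B U /nbhs_ballP[e e0 eU]; apply/nbhs_ballP; exists e => // B' [_ BB'].
by apply: eU; split=> // i j; rewrite !mxE; exact: BB'.
Qed.

Lemma compact_le_sqnorm p (M : R) (D : set 'rV[R]_p) :
  closed D -> D `<=` [set v | sqnorm v^T <= M] -> compact D.
Proof.
move=> clD DM; apply: bounded_closed_compact => //.
exists (1 + M); split=> [|K MK v /DM /= vM]; first exact: num_real.
have M0 : 0 <= M by rewrite (le_trans (sqnorm_ge0 _) vM).
rewrite [leLHS]/Num.norm /= mx_normrE; apply/bigmax_leP; split=> [|[i j] _ /=].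
  by rewrite ltW// (le_lt_trans _ MK)// addr_ge0.
rewrite (ord1 i).
have := le_trans (entry_le_sqnorm v^T j) vM; rewrite mxE => vjM.
(* The bound on the entry avoids a square root: x <= 1 + x^2. *)
have vj1 : `|v 0 j| <= 1 + `|v 0 j| ^+ 2 by have := sqr_ge0 (`|v 0 j| - 1); nra.
rewrite (le_trans vj1)// ltW// (le_lt_trans _ MK)// lerD2l.
by rewrite real_normK ?num_real.
Qed.

Lemma bounded_cluster p (M : R) (u : nat -> 'cV[R]_p) :
  (forall k, sqnorm (u k) <= M) ->
  exists a : 'cV[R]_p, forall e N, 0 < e ->
    exists2 k, (N <= k)%N & sqnorm (u k - a) < e.
Proof.
move=> uM; pose D := [set v : 'rV[R]_p | sqnorm v^T <= M].
have contD : continuous (fun v : 'rV[R]_p => sqnorm v^T).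
  move=> v; have tv := @tr_continuous 1 p v; exact: (cvg_dot tv tv).
have clD : closed D by apply: (closed_comp _ (@closed_le _ M)) => v _; exact: contD.
have cD : compact D by exact: (@compact_le_sqnorm _ M).
pose v k := (u k)^T.
have [|a [_ ca]] := cD (v @ \oo) _.
  by exists 0%N => // k _; rewrite /D /v /= trmxK.
exists a^T => e N e0.
have [] := ca (v @` [set k | (N <= k)%N])
              [set x : 'rV[R]_p | sqnorm (x^T - a^T) < e].
- by exists N => // k /= Nk; exists k.
- have /cvg_sqnormP/cvgrPdist_lt/(_ _ e0) := @tr_continuous 1 p a.
  by apply: filterS => x; rewrite sub0r normrN ger0_norm// sqnorm_ge0.
- by move=> _ [[k /= Nk <-] h]; exists k => //; move: h; rewrite /= /v trmxK.
Qed.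

(** Bolzano--Weierstrass. The indices only need to tend to infinity, so they
    are chosen one by one. *)
Lemma bounded_subsequence p (M : R) (u : nat -> 'cV[R]_p) :
  (forall k, sqnorm (u k) <= M) ->
  exists2 f : nat -> nat, f @ \oo --> \oo & cvgn (u \o f).
Proof.
move=> /bounded_cluster[a ua].
have /choice[f fP] : forall j, exists k, (j <= k)%N /\ sqnorm (u k - a) < j.+1%:R^-1.
  move=> j; have [|k jk h] := ua j.+1%:R^-1 j; first by rewrite invr_gt0.
  by exists k.
exists f.
  apply/cvgnyPge => N; near=> j; rewrite (leq_trans _ (fP j).1)//.
  by near: j; exact: nbhs_infty_ge.
apply/cvg_ex; exists a; apply/cvg_sqnormP.
apply: (@squeeze_cvgr _ _ _ _ (fun=> 0) (fun j => j.+1%:R^-1)).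
- by apply: nearW => j; rewrite sqnorm_ge0 ltW//=; case: (fP j).
- exact: cvg_cst.
- exact: cvg_harmonic.
Unshelve. all: end_near. Qed.

End Convergence.

(** * The largest eigenvalue of a Gram matrix *)

Section Eigenvalue.
Context {R : realType}.

(** Dividing by [t] and letting [t] tend to 0: this is how a minimum yields a
    first-order condition below. *)
Lemma linear_coef_ge0 (a b : R) :
  (forall t, 0 < t <= 1 -> 0 <= t * a + t ^+ 2 * b) -> 0 <= a.
Proof.
move=> h; rewrite leNgt; apply/negP => a0.
have d0 : 0 < `|b| + 1 - a by have := normr_ge0 b; lra.
pose t := - a / (`|b| + 1 - a).
have tE : t * (`|b| + 1 - a) = - a by rewrite /t divfK// gt_eqF.
have t01 : 0 < t <= 1.
  rewrite divr_gt0 ?oppr_gt0//= ler_pdivrMr// mul1r.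
  by have := normr_ge0 b; lra.
have := h t t01; have := ler_norm b; have := normr_ge0 b; nra.
Qed.

(** The maximum over the unit sphere of the Rayleigh quotient is attained,
    and a maximiser is an eigenvector; the maximum is positive as [A^T] maps
    some basis vector to a nonzero vector. *)
Lemma gram_eigenvalue_gt0 m n (A : 'M[R]_(m, n)) :
  A != 0 -> exists2 a, 0 < a & eigenvalue (A *m A^T) a.
Proof.
move=> A0; pose f (v : 'rV[R]_m) := sqnorm (A^T *m v^T).
pose S := [set v : 'rV[R]_m | sqnorm v^T = 1].
have [i fi] : exists i, 0 < f (delta_mx 0 i).
  have /matrix0Pn[i [j Aij]] := A0; exists i.
  rewrite /f sqnorm_gt0 trmx_delta -colE; apply: contra_neq Aij => c0.
  by have := congr1 (fun B : 'cV_n => B j 0) c0; rewrite !mxE.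
have Si : S (delta_mx 0 i).
  rewrite /S/= trmx_delta sqnormE (bigD1 i)//= big1 ?mxE ?eqxx ?expr1n ?addr0//.
  by move=> j ji; rewrite !mxE (negbTE ji) expr0n.
have trc v := @tr_continuous R 1 m v.
have contn : continuous (fun v : 'rV[R]_m => sqnorm v^T).
  by move=> v; exact: (cvg_dot (trc v) (trc v)).
have contf : continuous f.
  move=> v; have ctv := @cvg_mulmx _ _ _ _ _ (nbhs_filter v) A^T _ _ (trc v).
  exact: (cvg_dot ctv ctv).
have cS : compact S.
  apply: (@compact_le_sqnorm _ _ 1); last by move=> v /= ->.
  by apply: (closed_comp _ (@closed_eq R 1)) => v _; exact: contn.
have [|v /set_mem Sv vmax] := compact_EVT_max _ cS (continuous_subspaceT contf).
  by exists (delta_mx 0 i).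
set a := f v in vmax.
have a0 : 0 < a by rewrite (lt_le_trans fi)// vmax// inE.
have fle u : sqnorm (A^T *m u) <= a * sqnorm u.
  have [->|u0] := eqVneq u 0; first by rewrite mulmx0 !sqnorm0 mulr0.
  pose c := Num.sqrt (sqnorm u); have u1 : 0 < sqnorm u by rewrite sqnorm_gt0.
  have c2 : c ^+ 2 = sqnorm u by rewrite sqr_sqrtr// sqnorm_ge0.
  have Su : S (c^-1 *: u)^T.
    by rewrite /S/= trmxK sqnormZ exprVn c2 mulVf// gt_eqF.
  have := vmax _ (mem_set Su).
  by rewrite /f trmxK -scalemxAr sqnormZ exprVn c2 mulrC ler_pdivrMr.
exists a => //; apply/eigenvalueP; exists v; last first.
  rewrite -trmx_eq0 -sqnorm_gt0.
  by rewrite (Sv : sqnorm v^T = 1).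
set u := v^T in Sv.
pose g := A *m (A^T *m u) - a *: u.
suff g0 : g = 0.
  apply: trmx_inj; rewrite trmx_mul trmx_mul trmxK linearZ /= -/u -mulmxA.
  by apply/eqP; rewrite -subr_eq0 -/g g0.
have Su : sqnorm u = 1 by exact: Sv.
have au : a = sqnorm (A^T *m u) by [].
have gE : A *m (A^T *m u) = g + a *: u by rewrite subrK.
clearbody g; apply/eqP; rewrite -[_ == _]negbK -sqnorm_gt0 -leNgt -oppr_ge0.
have ineq t : 0 < t <= 1 -> 0 <= t * (2 * - sqnorm g) +
    t ^+ 2 * (a * sqnorm g - sqnorm (A^T *m g)).
  move=> _; have := fle (u + t *: g).
  rewrite mulmxDr !sqnormD -scalemxAr !sqnormZ !dotZr -au Su dot_mulmxr trmxK.
  have -> : dot (A *m (A^T *m u)) g = sqnorm g + a * dot u g.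
    by rewrite gE dotDl dotZl.
  by move=> h; lra.
by have := linear_coef_ge0 ineq; rewrite pmulr_rge0.
Qed.

(** A supremum over an unbounded set would be the default value 0, so the
    eigenvalues have to be bounded above; the squared Frobenius norm does it. *)
Lemma rho_gram_gt0 m n (A : 'M[R]_(m, n)) : A != 0 -> 0 < rho (A *m A^T).
Proof.
move=> /gram_eigenvalue_gt0[a a0 ea]; apply: (lt_le_trans a0).
apply: ub_le_sup => //; exists (\tr (A^T *m A^T^T)) => b /= /eigenvalueP[v vb v0].
have v1 : 0 < sqnorm v^T by rewrite sqnorm_gt0 trmx_eq0.
rewrite -(ler_pM2r v1); apply: le_trans (sqnorm_mulmx_le _ _).
have Av : A *m (A^T *m v^T) = b *: v^T.
  by apply: trmx_inj; rewrite !trmx_mul !trmxK -mulmxA vb linearZ/= trmxK.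
by rewrite /sqnorm dot_mulmxr trmxK Av dotZl.
Qed.

End Eigenvalue.

(** * Convex functions: continuity and first-order optimality *)

Section Convexity.
Context {R : realType} {p : nat}.
Implicit Types (f : 'cV[R]_p -> R) (C : set 'cV[R]_p).

Lemma convex_function_le f : is_convex_function f ->
  forall x y t, 0 <= t <= 1 ->
    f (t *: x + (1 - t) *: y) <= t * f x + (1 - t) * f y.
Proof.
move=> cf x y t /andP[t0 t1].
by have := cf (Itv01 t0 t1) x y; rewrite !in_setT; exact.
Qed.

Lemma convex_set_segment C : is_convex_set C ->
  forall x y t, C x -> C y -> 0 <= t <= 1 -> C (t *: x + (1 - t) *: y).
Proof.
move=> cC x y t Cx Cy /andP[t0 t1]; apply: set_mem.
exact: (cC x y (Itv01 t0 t1) (mem_set Cx) (mem_set Cy)).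
Qed.

Lemma convex_midpoint f : is_convex_function f ->
  forall x y, f (2^-1 *: (x + y)) <= 2^-1 * (f x + f y).
Proof.
move=> cf x y; have := @convex_function_le f cf x y 2^-1.
have -> : 1 - 2^-1 = 2^-1 :> R by lra.
by rewrite -scalerDr -mulrDr; apply; lra.
Qed.

Lemma convex_line_bound f : is_convex_function f ->
  forall x e, exists2 K, 0 <= K &
    forall t, `|t| <= 1 -> f (x + t *: e) - f x <= K * `|t|.
Proof.
move=> cf x e; pose K := Num.max 0 (Num.max (f (x + e) - f x) (f (x - e) - f x)).
exists K => [|t t1]; first by rewrite le_max lexx.
have K1 : f (x + e) - f x <= K by rewrite /K !le_max lexx !orbT.
have K2 : f (x - e) - f x <= K by rewrite /K !le_max lexx !orbT.
have t01 : 0 <= `|t| <= 1 by rewrite normr_ge0.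
have seg e' : f (x + `|t| *: e') - f x <= `|t| * (f (x + e') - f x).
  have := convex_function_le cf (x + e') x t01.
  have -> : `|t| *: (x + e') + (1 - `|t|) *: x = x + `|t| *: e'.
    by rewrite scalerDr scalerBl scale1r addrAC [_ + (x - _)]addrC subrK.
  by lra.
have := normr_ge0 t.
have [t0|t0] := leP 0 t.
  by have := seg e; rewrite (ger0_norm t0); nra.
by have := seg (- e); rewrite (ltr0_norm t0) scalerN scaleNr opprK; nra.
Qed.

(** The coordinates are added one at a time: [x + (d + d')] is the midpoint of
    [x + 2 d] and [x + 2 d'], so an upper bound that is linear in the size of the
    displacement survives, at the price of halving its range. *)
Lemma convex_coord_bound f : is_convex_function f ->
  forall x (s : seq 'I_p), exists K d, [/\ 0 <= K, 0 < d &
    forall (c : 'I_p -> R) e, e <= d -> (forall i, `|c i| <= e) ->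
      f (x + \sum_(i <- s) c i *: delta_mx i 0) - f x <= K * e].
Proof.
move=> cf x; elim=> [|i s [K [d [K0 d0 IH]]]].
  exists 0, 1; split=> // c e _ _.
  by rewrite big_nil addr0 subrr mul0r.
have [L L0 hL] := convex_line_bound cf x (delta_mx i 0).
exists (L + K), (Num.min d 1 / 2); split; first by rewrite addr_ge0.
  by rewrite divr_gt0// lt_min d0 ltr01.
move=> c e; rewrite ler_pdivlMr// le_min => /andP[ed e1] ce.
rewrite big_cons; set S := \sum_(j <- s) _.
have := convex_midpoint cf (x + (2 * c i) *: delta_mx i 0)
  (x + \sum_(j <- s) (2 * c j) *: delta_mx j 0).
have -> : \sum_(j <- s) (2 * c j) *: delta_mx j 0 = 2 *: S :> 'cV[R]_p.
  by rewrite scaler_sumr; apply: eq_bigr => j _; rewrite scalerA.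
rewrite -scalerA.
have -> : 2^-1 *: (x + 2 *: (c i *: delta_mx i 0) + (x + 2 *: S)) =
    x + (c i *: delta_mx i 0 + S).
  by apply/matrixP => k l; rewrite !mxE; lra.
move=> mid.
have h1 : f (x + 2 *: (c i *: delta_mx i 0)) - f x <= L * (e * 2).
  have c1 : `|2 * c i| <= e * 2.
    by rewrite normrM ger0_norm// mulrC ler_pM2r.
  rewrite scalerA (le_trans (hL _ (le_trans c1 e1)))//.
  by rewrite ler_wpM2l.
have h2 : f (x + 2 *: S) - f x <= K * (e * 2).
  rewrite /S scaler_sumr.
  under eq_bigr do rewrite scalerA.
  apply: IH => // j; rewrite normrM ger0_norm// mulrC ler_pM2r//.
lra.
Qed.

(** A finite convex function lies locally below a cone at each point; reflecting
    the displacement through the point gives the matching lower bound. *)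
Lemma convex_continuous f : is_convex_function f -> continuous f.
Proof.
move=> cf x.
have [K [d [K0 d0 hK]]] := convex_coord_bound cf x (enum 'I_p).
have bnd (v : 'cV[R]_p) e : e <= d -> (forall i, `|v i 0| <= e) ->
    f (x + v) - f x <= K * e.
  move=> ed ve; have := hK (fun i => v i 0) e ed ve.
  rewrite big_enum /= (_ : \sum_i _ = v)//.
  rewrite [RHS]matrix_sum_delta; apply: eq_bigr => i _.
  by rewrite big_ord1.
apply/(@cvgrPdist_lt _ _ _ _ (nbhs_filter x)) => e e0; pose b := Num.min d (e / (K + 1)).
have K1 : 0 < K + 1 by lra.
have b0 : 0 < b by rewrite lt_min d0 divr_gt0.
have bd : b <= d by rewrite ge_min lexx.
have Kb : K * b < e.
  have : b <= e / (K + 1) by rewrite ge_min lexx orbT.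
  by rewrite ler_pdivlMr//; nra.
apply/nbhs_ballP; exists b => // y [_ xy].
pose v := y - x.
have vb i : `|v i 0| <= b by rewrite !mxE distrC; apply: ltW; exact: xy.
have up := bnd v b bd vb.
have nvb i : `|(- v) i 0| <= b by rewrite mxE normrN.
have dn := bnd (- v) b bd nvb.
have := convex_midpoint cf (x + v) (x - v).
have -> : 2^-1 *: (x + v + (x - v)) = x.
  by apply/matrixP => k l; rewrite !mxE; lra.
have yE : x + v = y by rewrite addrC subrK.
rewrite yE in up * => mid.
by rewrite ltr_norml; apply/andP; split; lra.
Qed.

(** The increment of [f] plus the derivative of the quadratic part bounds from
    above the one-sided slope of the objective at [z] towards [x], and that slope is
    nonnegative at a minimiser. *)
Lemma proximal_variational_inequality f C (q c z : 'cV[R]_p) (r : R) :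
  is_convex_function f -> is_convex_set C ->
  argmin C (fun x => f x + dot q x + r / 2 * sqnorm (x - c)) z ->
  forall x, C x -> 0 <= f x - f z + dot (x - z) (q + r *: (z - c)).
Proof.
move=> cf cC [Cz zmin] x Cx; pose h := x - z.
apply: (@linear_coef_ge0 _ _ (r / 2 * sqnorm h)) => t /andP[t0 t1].
have t01 : 0 <= t <= 1 by rewrite ltW.
have xt : t *: x + (1 - t) *: z = z + t *: h.
  by rewrite scalerBr scalerBl scale1r addrCA addrA addrC.
have Cxt : C (z + t *: h) by rewrite -xt; exact: convex_set_segment.
have := convex_function_le cf x z t01; rewrite xt.
have := zmin _ Cxt.
have -> : z + t *: h - c = (z - c) + t *: h by rewrite addrAC.
rewrite (sqnormD (z - c)) sqnormZ dotZr [dot q (_ + _)]dotDr dotZr.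
rewrite [dot h _]dotDr dotZr (dotC h q) (dotC h) -/h.
lra.
Qed.

End Convexity.

(** * Fejer monotone sequences *)

Section Fejer.
Context {R : realType}.

Lemma decrease_cvg0 (a b : nat -> R) :
  (forall k, 0 <= a k) -> (forall k, 0 <= b k) ->
  (forall k, a k.+1 <= a k - b k) -> b @ \oo --> 0.
Proof.
move=> a0 b0 ab.
have da : nonincreasing_seq a.
  by apply/nonincreasing_seqP => k; have := ab k; have := b0 k; lra.
have ca : cvgn a.
  by apply: nonincreasing_is_cvgn => //; exists 0 => _ [k _ <-].
apply: (@squeeze_cvgr _ _ _ _ (fun=> 0) (fun k => a k - a k.+1)).
- by apply: nearW => k; have := ab k; have := b0 k; lra.
- exact: cvg_cst.
- rewrite -(subrr (limn a)); apply: cvgB => //.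
  by have := ca; rewrite -cvg_shiftS.
Qed.

(** Boundedness produces a limit point; once that limit point is known to be in
    [Z], the distance to it is itself monotone and vanishes along a subsequence,
    hence vanishes. *)
Lemma fejer_cvg p (q : 'cV[R]_p -> R) (l u : R) (Z : set 'cV[R]_p)
    (w : nat -> 'cV[R]_p) :
  0 < l -> (forall v, l * sqnorm v <= q v <= u * sqnorm v) ->
  Z !=set0 -> (forall z, Z z -> forall k, q (w k.+1 - z) <= q (w k - z)) ->
  (forall f z, f @ \oo --> \oo -> w \o f @ \oo --> z -> Z z) ->
  exists2 z, Z z & w @ \oo --> z.
Proof.
move=> l0 qb [z0 Zz0] mono lims.
have decr z : Z z -> nonincreasing_seq (fun k => q (w k - z)).
  by move=> Zz; apply/nonincreasing_seqP => k; exact: mono.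
have q0 v : 0 <= q v.
  by have /andP[+ _] := qb v; apply: le_trans; rewrite mulr_ge0 ?sqnorm_ge0// ltW.
have lq v : sqnorm v <= l^-1 * q v.
  by have /andP[+ _] := qb v; rewrite ler_pdivlMl.
have [f foo /cvg_ex[v fv]] : exists2 f : nat -> nat, f @ \oo --> \oo &
    cvgn ((fun k => w k - z0) \o f).
  apply: (@bounded_subsequence _ _ (l^-1 * q (w 0%N - z0))) => k.
  apply: le_trans (lq _) _; rewrite ler_pM2l ?invr_gt0//.
  by have := decr _ Zz0 0%N k; apply.
have wf : w \o f @ \oo --> v + z0.
  rewrite (_ : w \o f = fun j => w (f j) - z0 + z0).
    by apply: cvgD => //; exact: cvg_cst.
  by apply/funext => j /=; rewrite subrK.
have Zz := lims _ _ foo wf; exists (v + z0) => //.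
set z := v + z0 in wf Zz *.
have cq : cvgn (fun k => q (w k - z)).
  by apply: nonincreasing_is_cvgn; [exact: decr|exists 0 => _ [k _ <-]].
have qf0 : (fun j => q (w (f j) - z)) @ \oo --> (0 : R).
  apply: (@squeeze_cvgr _ _ _ _ (fun=> 0) (fun j => u * sqnorm (w (f j) - z))).
  - by apply: nearW => j; rewrite q0; case/andP: (qb (w (f j) - z)).
  - exact: cvg_cst.
  - rewrite -(mulr0 u); apply: cvgM; first exact: cvg_cst.
    by move/cvg_sqnormP : wf.
have q_cvg0 : (fun k => q (w k - z)) @ \oo --> (0 : R).
  have qf := cvg_comp _ _ foo cq.
  by rewrite -(cvg_unique _ qf qf0).
apply/cvg_sqnormP.
apply: (@squeeze_cvgr _ _ _ _ (fun=> 0) (fun k => l^-1 * q (w k - z))).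
- by apply: nearW => k; rewrite sqnorm_ge0 lq.
- exact: cvg_cst.
- by rewrite -(mulr0 l^-1); apply: cvgM => //; exact: cvg_cst.
Qed.

End Fejer.

(** * The step sizes of the dual loop *)

Section StepSizes.
Context {R : realType} {n m : nat}.
Variables (A : 'M[R]_(m, n)).
Variables (theta1 : 'cV[R]_n -> R) (theta2 : 'cV[R]_m -> R).
Variables (X : set 'cV[R]_n) (Y : set 'cV[R]_m).

Lemma backtrack_y_step r nu theta xt yk s s' yt :
  backtrack A theta1 theta2 Y r nu theta xt yk s s' yt ->
  y_step A theta1 theta2 Y s' xt yk yt.
Proof. by elim. Qed.

(** Each rejected trial has [ratio > nu], so the update multiplies [s] by more
    than [nu * theta > 1]; on the other hand [s * ratio] no longer depends on [s]
    and is at most the squared Frobenius norm of [A] over [r]. *)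
Lemma backtrack_bounds r nu theta xt yk s s' yt :
  0 < r -> 0 < nu -> 1 / nu < theta -> 0 < s ->
  backtrack A theta1 theta2 Y r nu theta xt yk s s' yt ->
  s <= s' <= Num.max s (theta * (\tr (A^T *m A^T^T) / r)).
Proof.
move=> r0 nu0 th s0 bt; have nuth : 1 < theta * nu by rewrite -ltr_pdivrMr.
have th0 : 0 < theta by rewrite (lt_trans _ th)// divr_gt0.
elim: bt s0 => [{}s {}yt _ _ s0|{}s {}yt {}s' yt' _ h _ IH s0].
  by rewrite le_max !lexx.
set t := Defs.ratio A r s yk yt in h IH *.
have t0 : 0 < t by exact: lt_trans h.
have stth : s <= s * t * theta.
  rewrite -mulrA ler_peMr ?ltW//; apply: lt_trans nuth _.
  by rewrite mulrC ltr_pM2r.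
have /andP[/(le_trans stth) -> s'le] := IH (lt_le_trans s0 stth).
apply: le_trans s'le _.
rewrite le_max; apply/orP; right; rewrite ge_max lexx andbT.
rewrite mulrC ler_pM2l// /t /Defs.ratio.
case: eqP h => [e|/eqP e _]; first by rewrite /t /Defs.ratio e eqxx ltNge ltW.
have d0 : 0 < sqnorm (yk - yt) by rewrite sqnorm_gt0 subr_eq0 eq_sym.
set N := sqnorm (_ *m _); set D := sqnorm _ in d0 *.
have -> : s * (r^-1 * N / (s * D)) = r^-1 * N / D.
  by field; rewrite !gt_eqF.
rewrite ler_pdivrMr// [_ / r]mulrC -mulrA ler_pM2l ?invr_gt0//.
exact: sqnorm_mulmx_le.
Qed.

(** The reduction between iterations never goes below [smin], and it happens only
    above [smin], so it never increases the step either. *)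
Lemma apdhg_step_bounds r s0 sa smin gamma nu mu theta w wt sinit s :
  0 < r -> 0 < nu -> 1 / nu < theta -> 0 < s0 -> 0 < smin ->
  apdhg A theta1 theta2 X Y r s0 sa smin gamma nu mu theta w wt sinit s ->
  forall k, Num.min s0 smin <= s k <=
    Num.max s0 (theta * (\tr (A^T *m A^T^T) / r)).
Proof.
move=> r0 nu0 th s00 smin0 run.
set lo := Num.min s0 smin; set hi := Num.max _ _.
have lo0 : 0 < lo by rewrite lt_min s00.
have bt k : lo <= sinit k <= hi -> lo <= s k <= hi.
  move=> /andP[lok khi].
  have /andP[h1 h2] :=
    backtrack_bounds r0 nu0 th (lt_le_trans lo0 lok) (apdhg_y run k).
  rewrite (le_trans lok h1) (le_trans h2)// ge_max khi.
  by rewrite /hi le_max lexx orbT.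
have init k : lo <= sinit k <= hi.
  elim: k => [|k /bt /andP[lok khi]].
    by rewrite (apdhg_init run) /lo /hi ge_min le_max !lexx.
  rewrite (apdhg_s run); case: ifP => [/andP[_ smins]|_]; last by rewrite lok.
  rewrite ge_max le_max (_ : lo <= smin) ?orbT/=; last by rewrite ge_min lexx orbT.
  by rewrite !(le_trans _ khi)// ?ltW//; lra.
by move=> k; exact: bt.
Qed.

End StepSizes.

(** * One iteration of the method *)

Section Iteration.
Context {R : realType} {n m : nat}.
Variables (A : 'M[R]_(m, n)).
Variables (theta1 : 'cV[R]_n -> R) (theta2 : 'cV[R]_m -> R).
Variables (X : set 'cV[R]_n) (Y : set 'cV[R]_m).
Hypotheses (theta1_convex : is_convex_function theta1)
  (theta2_convex : is_convex_function theta2)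
  (X_convex : is_convex_set X) (Y_convex : is_convex_set Y).

Lemma bilinear_dot (x : 'cV[R]_n) (y : 'cV[R]_m) :
  (y^T *m A *m x) 0 0 = dot (A^T *m y) x.
Proof. by rewrite /dot trmx_mul trmxK. Qed.

Lemma x_step_vi r xk yk xt : x_step A theta1 theta2 X r xk yk xt ->
  forall x, X x ->
    0 <= theta1 x - theta1 xt + dot (x - xt) (- (A^T *m yk) + r *: (xt - xk)).
Proof.
move=> [Xxt xmin]; apply: proximal_variational_inequality => //.
split=> // z Xz; have := xmin z Xz.
by rewrite /Phi !bilinear_dot !dotNl; lra.
Qed.

Lemma y_step_vi s xt yk yt : y_step A theta1 theta2 Y s xt yk yt ->
  forall y, Y y ->
    0 <= theta2 y - theta2 yt + dot (y - yt) (A *m xt + s *: (yt - yk)).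
Proof.
move=> [Yyt ymax]; apply: proximal_variational_inequality => //.
split=> // z Yz; have := ymax z Yz.
by rewrite /Phi !bilinear_dot -!dot_mulmxr !(dotC _ (A *m xt)); lra.
Qed.

Lemma saddle_points_Omega_star z : saddle_points A theta1 theta2 X Y z ->
  Omega_star A theta1 theta2 X Y (col_mx z.1 z.2).
Proof.
move=> [Xz Yz saddle]; split; first by split; rewrite ?col_mxKu ?col_mxKd.
move=> w [Xw Yw]; have [h1 h2] := saddle _ _ Xw Yw.
rewrite /thetaW /F !col_mxKu !col_mxKd -[w]vsubmxK opp_col_mx add_col_mx dot_col.
rewrite !col_mxKu !col_mxKd; move: h1 h2; rewrite /Phi !bilinear_dot.
by rewrite !dot_bilinear !(dotC _ (A^T *m z.2)) !dot_mulmxr; lra.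
Qed.

Lemma mul_QPD r s (d : 'cV[R]_(n + m)) :
  QPD A r s *m d =
  col_mx (r *: usubmx d + A^T *m dsubmx d) (s *: dsubmx d).
Proof.
by rewrite -[d in LHS]vsubmxK mul_block_col !mul_scalar_mx mul0mx add0r.
Qed.

Lemma mul_MPD r sa s (d : 'cV[R]_(n + m)) :
  MPD A r sa s *m d =
  col_mx (usubmx d + r^-1 *: (A^T *m dsubmx d)) ((s / sa) *: dsubmx d).
Proof.
rewrite -[d in LHS]vsubmxK mul_block_col !mul_scalar_mx mul0mx add0r scale1r.
by rewrite scalemxAl.
Qed.

Lemma mul_HPD r sa (d : 'cV[R]_(n + m)) :
  HPD r sa *m d = col_mx (r *: usubmx d) (sa *: dsubmx d).
Proof.
by rewrite -[d in LHS]vsubmxK mul_block_col !mul_scalar_mx !mul0mx add0r addr0.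
Qed.

Lemma mul_HPD_MPD r sa s (d : 'cV[R]_(n + m)) : r != 0 -> sa != 0 ->
  HPD r sa *m (MPD A r sa s *m d) = QPD A r s *m d.
Proof.
move=> r0 sa0; rewrite mul_HPD mul_MPD mul_QPD col_mxKu col_mxKd.
by rewrite scalerDr !scalerA divff// scale1r mulrCA divff// mulr1.
Qed.

Lemma sqnormH_HPD r sa (d : 'cV[R]_(n + m)) :
  sqnormH (HPD r sa) d = r * sqnorm (usubmx d) + sa * sqnorm (dsubmx d).
Proof.
rewrite /sqnormH -mulmxA -/(dot _ _) mul_HPD -[d in dot d _]vsubmxK dot_col.
by rewrite !dotZr.
Qed.

Lemma sqnormH_HPDB r sa b (e v : 'cV[R]_(n + m)) :
  sqnormH (HPD r sa) (e - b *: v) =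
  sqnormH (HPD r sa) e - 2 * b * dot e (HPD r sa *m v)
    + b ^+ 2 * sqnormH (HPD r sa) v.
Proof.
rewrite mul_HPD -[e in dot e _]vsubmxK dot_col !sqnormH_HPD.
have -> : usubmx (e - b *: v) = usubmx e - b *: usubmx v.
  by rewrite linearB linearZ.
have -> : dsubmx (e - b *: v) = dsubmx e - b *: dsubmx v.
  by rewrite linearB linearZ.
by rewrite !sqnormB !sqnormZ !dotZr; ring.
Qed.

(** Adding the variational inequalities of the two subproblems, tested at the
    solution, to the one defining the solution, tested at the trial point, cancels
    the objective values and, by skew-symmetry, the product of [wt - ws] with
    [F wt - F ws]; the term with [Q] remains. *)
Lemma trial_cross_ge0 r s (w wt ws : 'cV[R]_(n + m)) :
  x_step A theta1 theta2 X r (usubmx w) (dsubmx w) (usubmx wt) ->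
  y_step A theta1 theta2 Y s (usubmx wt) (dsubmx w) (dsubmx wt) ->
  Omega_star A theta1 theta2 X Y ws ->
  0 <= dot (wt - ws) (QPD A r s *m (w - wt)).
Proof.
move=> xs ys [[Xs Ys] sol].
have Ot : Omega X Y wt by split; [case: xs | case: ys].
have := sol _ Ot; have := y_step_vi ys Ys; have := x_step_vi xs Xs.
rewrite mul_QPD /thetaW /F -[wt - ws]vsubmxK !dot_col !linearB /=.
set x := usubmx w; set xt := usubmx wt; set x1 := usubmx ws.
set y := dsubmx w; set yt := dsubmx wt; set y1 := dsubmx ws.
rewrite !dot_bilinear !(dotC _ (A^T *m _)) !dot_mulmxr.
lra.
Qed.

(** Half of [r |dx|^2] and [|A^T dy|^2 / (2 r) <= nu s |dy|^2 / 2] absorb the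
    coupling term. *)
Lemma coupling_ge r s nu (dx : 'cV[R]_n) (dy : 'cV[R]_m) :
  0 < r -> 0 < s -> 0 < nu < 1 ->
  1 / r * sqnorm (A^T *m dy) <= nu * s * sqnorm dy ->
  r * sqnorm dx + s * sqnorm dy <=
    2 * (r * sqnorm dx + dot dx (A^T *m dy) + s * sqnorm dy).
Proof.
move=> r0 s0 nu01; set g := A^T *m dy => rel.
have := sqnorm_ge0 (r *: dx + g); rewrite sqnormD sqnormZ dotZl => sq.
have sq' : 0 <= r * sqnorm dx + 2 * dot dx g + 1 / r * sqnorm g.
  rewrite -(pmulr_rge0 _ r0) (le_trans sq)// le_eqVlt; apply/orP; left.
  by apply/eqP; field; rewrite gt_eqF.
have := sqnorm_ge0 dy; have := mulr_ge0 (ltW s0) (sqnorm_ge0 dy); nra.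
Qed.

End Iteration.

Section Decrease.
Context {R : realType} {n m : nat}.
Variables (A : 'M[R]_(m, n)).

(** Unlike the squared H-norm it weighs the dual block by the current step [s], not
    by [sa]: this is the scale on which the numerator of [alpha_star] is bounded from
    below and its denominator from above. *)
Definition residual (r s : R) (d : 'cV[R]_(n + m)) : R :=
  r * sqnorm (usubmx d) + s * sqnorm (dsubmx d).

Lemma residual_ge0 r s d : 0 < r -> 0 < s -> 0 <= residual r s d.
Proof. by move=> r0 s0; rewrite addr_ge0// mulr_ge0 ?sqnorm_ge0// ltW. Qed.

Lemma residual_gt0 r s d : 0 < r -> 0 < s -> d != 0 -> 0 < residual r s d.
Proof.
move=> r0 s0 d0; have : 0 < sqnorm d by rewrite sqnorm_gt0.
rewrite sqnorm_submx /residual.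
have := sqnorm_ge0 (usubmx d); have := sqnorm_ge0 (dsubmx d).
rewrite [0 <= sqnorm (usubmx d)]le_eqVlt => y0 /orP[/eqP <-|x0 _].
  by rewrite mulr0 !add0r => y1; rewrite mulr_gt0.
by rewrite ltr_wpDr ?mulr_ge0 ?mulr_gt0// ltW.
Qed.

Lemma dot_QPD_ge r s nu (d : 'cV[R]_(n + m)) :
  0 < r -> 0 < s -> 0 < nu < 1 ->
  1 / r * sqnorm (A^T *m dsubmx d) <= nu * s * sqnorm (dsubmx d) ->
  residual r s d <= 2 * dot d (QPD A r s *m d).
Proof.
move=> r0 s0 nu01 rel; rewrite mul_QPD -[d in dot d _]vsubmxK dot_col.
by rewrite dotDr !dotZr; exact: coupling_ge rel.
Qed.

Lemma sqnormH_MPD_le r sa s S nu (d : 'cV[R]_(n + m)) :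
  0 < r -> 0 < s -> 0 < sa -> s <= S -> 0 < nu < 1 ->
  1 / r * sqnorm (A^T *m dsubmx d) <= nu * s * sqnorm (dsubmx d) ->
  sqnormH (HPD r sa) (MPD A r sa s *m d) <= (2 + S / sa) * residual r s d.
Proof.
move=> r0 s0 sa0 sS nu01 rel.
rewrite mul_MPD sqnormH_HPD col_mxKu col_mxKd sqnormZ /residual.
set dx := usubmx d; set dy := dsubmx d; set g := A^T *m dy in rel *.
have par : r * sqnorm (dx + r^-1 *: g) <= 2 * (r * sqnorm dx) + 2 * (1 / r * sqnorm g).
  (* |u + v|^2 + |u - v|^2 = 2 |u|^2 + 2 |v|^2 *)
  have := sqnorm_ge0 (dx - r^-1 *: g).
  rewrite sqnormB sqnormD !sqnormZ !dotZr => h.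
  rewrite -subr_ge0; have := mulr_ge0 (ltW r0) h.
  move/le_trans; apply; rewrite le_eqVlt; apply/orP; left; apply/eqP.
  by field; rewrite gt_eqF.
have y0 : 0 <= s * sqnorm dy by rewrite mulr_ge0 ?sqnorm_ge0// ltW.
have x0 : 0 <= r * sqnorm dx by rewrite mulr_ge0 ?sqnorm_ge0// ltW.
have -> : sa * ((s / sa) ^+ 2 * sqnorm dy) = s / sa * (s * sqnorm dy).
  by field; rewrite gt_eqF.
have q0 : 0 <= s / sa by rewrite divr_ge0// ltW.
have qS : s / sa <= S / sa by rewrite ler_pM2r// invr_gt0.
have nuy : nu * s * sqnorm dy <= s * sqnorm dy.
  by rewrite -mulrA ler_piMl// ltW//; lra.
have h1 := ler_wpM2r y0 qS.
have h2 := mulr_ge0 (le_trans q0 qS) x0.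
lra.
Qed.

(** With [phi = d^T Q d] and [N = |M d|_H^2], the cross term bounds the change of
    the squared distance by [- 2 b phi + b^2 N], where [b] is the step length.
    [alpha_star = phi / N] minimises this bound, and a factor [gamma] in ]0, 2[
    keeps a share [gamma (2 - gamma)] of the optimal decrease [phi^2 / N]. *)
Lemma relaxed_step_decrease r sa s S nu gamma (w wt ws : 'cV[R]_(n + m)) :
  0 < r -> 0 < s -> 0 < sa -> s <= S -> 0 < nu < 1 -> 0 < gamma < 2 ->
  1 / r * sqnorm (A^T *m dsubmx (w - wt)) <= nu * s * sqnorm (dsubmx (w - wt)) ->
  w != wt -> 0 <= dot (wt - ws) (QPD A r s *m (w - wt)) ->
  sqnormH (HPD r sa)
    (w - (gamma * alpha_star A r sa s w wt) *: (MPD A r sa s *m (w - wt)) - ws)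
  <= sqnormH (HPD r sa) (w - ws)
     - gamma * (2 - gamma) / (4 * (2 + S / sa)) * residual r s (w - wt).
Proof.
move=> r0 s0 sa0 sS nu01 gam rel wwt cross.
rewrite addrAC sqnormH_HPDB mul_HPD_MPD ?gt_eqF// /alpha_star.
have -> : w - ws = (wt - ws) + (w - wt) by rewrite [RHS]addrC addrA subrK.
set d := w - wt in rel cross *; rewrite dotDl.
have d0 : d != 0 by rewrite subr_eq0.
have Tgt := residual_gt0 r0 s0 d0.
have Tphi := dot_QPD_ge r0 s0 nu01 rel.
have NT := sqnormH_MPD_le r0 s0 sa0 sS nu01 rel.
set T := residual r s d in Tgt Tphi NT *.
set P := dot _ (QPD A r s *m d) in cross *.
have N0 : 0 < sqnormH (HPD r sa) (MPD A r sa s *m d).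
  rewrite sqnormH_HPD; apply: residual_gt0 => //.
  (* H M d = Q d, so M d = 0 would force d^T Q d = 0. *)
  apply: contraTneq Tphi => Md0.
  rewrite -(@mul_HPD_MPD _ _ _ A r sa s d) ?gt_eqF// Md0 mulmx0 -ltNge.
  by rewrite dotC dot0l mulr0.
set phi := dot d (QPD A r s *m d) in Tphi *.
set N := sqnormH (HPD r sa) (MPD A r sa s *m d) in NT N0 *.
set E := sqnormH _ _; set C := 2 + S / sa in NT *.
have S0 : 0 < S by exact: lt_le_trans sS.
have C0 : 0 < C by rewrite addr_gt0// divr_gt0.
have phi0 : 0 < phi by lra.
have gain : T / (4 * C) <= phi ^+ 2 / N.
  rewrite ler_pdivrMr ?mulr_gt0// mulrAC ler_pdivlMr//.
  have T2 : T ^+ 2 <= 4 * phi ^+ 2 by nra.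
  have := ler_wpM2l (ltW Tgt) NT; have := ler_wpM2l (ltW C0) T2; lra.
have a0 : 0 <= gamma * (phi / N) * P.
  apply: mulr_ge0 => //; apply: mulr_ge0; last by rewrite divr_ge0// ltW.
  by case/andP: gam => /ltW.
have g2 : 0 < gamma * (2 - gamma) by nra.
have := ler_wpM2l (ltW g2) gain.
have -> : (gamma * (phi / N)) ^+ 2 * N = gamma ^+ 2 * (phi ^+ 2 / N).
  by field; rewrite gt_eqF.
have -> : 2 * (gamma * (phi / N)) * (P + phi) =
    2 * (gamma * (phi / N) * P) + 2 * gamma * (phi ^+ 2 / N).
  by field; rewrite gt_eqF.
have -> : gamma * (2 - gamma) / (4 * C) * T = gamma * (2 - gamma) * (T / (4 * C)).
  by rewrite -!mulrA [_^-1 * T]mulrC.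
lra.
Qed.

End Decrease.

(** * Limit points of the iterates are solutions *)

Section LimitPoints.
Context {R : realType} {n m : nat}.
Variables (A : 'M[R]_(m, n)).
Variables (theta1 : 'cV[R]_n -> R) (theta2 : 'cV[R]_m -> R).
Variables (X : set 'cV[R]_n) (Y : set 'cV[R]_m).
Hypotheses (theta1_convex : is_convex_function theta1)
  (theta2_convex : is_convex_function theta2)
  (X_convex : is_convex_set X) (Y_convex : is_convex_set Y)
  (X_closed : closed X) (Y_closed : closed Y).

(** Continuity of [f] lets [f (z j)] pass to the limit; [e] stands for the proximal
    term, which vanishes along the iterates. *)
Lemma vi_limit p (f : 'cV[R]_p -> R) (C : set 'cV[R]_p)
    (z g e : nat -> 'cV[R]_p) (zoo goo : 'cV[R]_p) :
  is_convex_function f -> closed C -> (forall j, C (z j)) ->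
  z @ \oo --> zoo -> g @ \oo --> goo -> e @ \oo --> (0 : 'cV[R]_p) ->
  (forall j x, C x -> 0 <= f x - f (z j) + dot (x - z j) (g j + e j)) ->
  C zoo /\ forall x, C x -> 0 <= f x - f zoo + dot (x - zoo) goo.
Proof.
move=> cf clC Cz zz gg ee vi; split.
  by apply: (@closed_cvg _ _ _ _ z C clC _ _ zz); exact: nearW.
move=> x Cx; rewrite -(addr0 goo).
have lim : (fun j => f x - f (z j) + dot (x - z j) (g j + e j)) @ \oo -->
    f x - f zoo + dot (x - zoo) (goo + 0).
  apply: cvgD.
    apply: cvgB; first exact: cvg_cst.
    exact: (continuous_cvg _ (@convex_continuous _ _ _ cf zoo) zz).
  apply: cvg_dot; last exact: cvgD.
  by apply: cvgB => //; exact: cvg_cst.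
apply: (cvgr_to_ge lim).
by apply: nearW => j; exact: vi.
Qed.

Lemma limit_point_Omega_star (r hi : R) (s : nat -> R)
    (w wt : nat -> 'cV[R]_(n + m)) (z : 'cV[R]_(n + m)) :
  (forall k, 0 < s k <= hi) ->
  (forall k, x_step A theta1 theta2 X r (usubmx (w k)) (dsubmx (w k))
    (usubmx (wt k))) ->
  (forall k, y_step A theta1 theta2 Y (s k) (usubmx (wt k)) (dsubmx (w k))
    (dsubmx (wt k))) ->
  w @ \oo --> z -> (fun k => w k - wt k) @ \oo --> (0 : 'cV[R]_(n + m)) ->
  Omega_star A theta1 theta2 X Y z.
Proof.
move=> s_bnd xs ys wz d0.
have wtz : wt @ \oo --> z.
  rewrite (_ : wt = fun k => w k - (w k - wt k)).
    by rewrite -(subr0 z); apply: cvgB.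
  by apply/funext => k; rewrite subKr.
have wtw0 : (fun k => wt k - w k) @ \oo --> (0 : 'cV[R]_(n + m)).
  by rewrite -(subrr z); apply: cvgB.
have ex0 : (fun k => r *: (usubmx (wt k) - usubmx (w k))) @ \oo --> (0 : 'cV[R]_n).
  apply: (cvg_sqnorm_le (K := r ^+ 2) _ wtw0) => k.
  rewrite !subr0 sqnormZ ler_wpM2l ?sqr_ge0// -linearB [leRHS]sqnorm_submx.
  by rewrite lerDl sqnorm_ge0.
have ey0 : (fun k => s k *: (dsubmx (wt k) - dsubmx (w k))) @ \oo --> (0 : 'cV[R]_m).
  apply: (cvg_sqnorm_le (K := hi ^+ 2) _ wtw0) => k; have /andP[sk0 skhi] := s_bnd k.
  rewrite !subr0 sqnormZ -linearB [sqnorm (wt k - w k)]sqnorm_submx.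
  apply: ler_pM; rewrite ?sqr_ge0 ?sqnorm_ge0 ?lerDr ?sqnorm_ge0//.
  by rewrite ler_pXn2r// nnegrE ltW// (lt_le_trans sk0).
have gx : (fun k => - (A^T *m dsubmx (w k))) @ \oo --> - (A^T *m dsubmx z).
  by apply: cvgN; apply: cvg_mulmx; exact: cvg_dsubmx.
have gy : (fun k => A *m usubmx (wt k)) @ \oo --> A *m usubmx z.
  by apply: cvg_mulmx; exact: cvg_usubmx.
have [Xz vx] := vi_limit theta1_convex X_closed (fun k => (xs k).1)
  (cvg_usubmx wtz) gx ex0 (fun k => x_step_vi theta1_convex X_convex (xs k)).
have [Yz vy] := vi_limit theta2_convex Y_closed (fun k => (ys k).1)
  (cvg_dsubmx wtz) gy ey0 (fun k => y_step_vi theta2_convex Y_convex (ys k)).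
split=> // v [Xv Yv]; have := vx _ Xv; have := vy _ Yv.
rewrite /thetaW /F -[v - z]vsubmxK dot_col !linearB/=; lra.
Qed.

End LimitPoints.

(** * Convergence *)

Unset Implicit Arguments.

Theorem theorem4p1 (R : realType) (n m : nat) (A : 'M[R]_(m, n))
  (theta1 : 'cV[R]_n -> R) (theta2 : 'cV[R]_m -> R)
  (X : set 'cV[R]_n) (Y : set 'cV[R]_m)
  (tau kappa r s0 sa smin gamma nu mu theta : R)
  (w wt : nat -> 'cV[R]_(n + m)) (sinit s : nat -> R)
  (A_neq0 : A != 0)
  (theta1_convex : is_convex_function theta1)
  (theta2_convex : is_convex_function theta2)
  (X_closed : closed X) (X_convex : is_convex_set X)
  (Y_closed : closed Y) (Y_convex : is_convex_set Y)
  (saddle_neq0 : saddle_points A theta1 theta2 X Y !=set0)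
  (tau_bounds : 1 / 5 <= tau <= 5)
  (kappa_bounds : 1 / 10 <= kappa <= 10)
  (r_def : r = tau * rho_average (A^T *m A))
  (s0_def : s0 = 3 / (2 * r) * rho_average (A *m A^T))
  (sa_def : sa = 1 / r * kappa * rho_average (A *m A^T))
  (smin_def :
    smin = Num.sqrt (rho_average (A *m A^T) / rho (A *m A^T)) * sa)
  (gamma_bounds : 0 < gamma < 2)
  (nu_bounds : 0 < nu < 1)
  (mu_bounds : 0 < mu < nu)
  (theta_bound : 1 / nu < theta)
  (run : apdhg A theta1 theta2 X Y r s0 sa smin gamma nu mu theta
           w wt sinit s)
  (no_stop : forall k, w k <> wt k)
  (relaxed : forall k,
    1 / r * sqnorm (A^T *m (dsubmx (w k) - dsubmx (wt k)))
      <= nu * s k * sqnorm (dsubmx (w k) - dsubmx (wt k))) :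
  exists2 winf : 'cV[R]_(n + m),
    Omega_star A theta1 theta2 X Y winf & w @ \oo --> winf.
Proof.
have trA : 0 < \tr (A *m A^T) by exact: trace_mulmx_tr_gt0.
have [i [j _]] := matrix0Pn _ A_neq0.
have n0 : 0 < n%:R :> R by rewrite ltr0n (leq_ltn_trans _ (ltn_ord j)).
have m0 : 0 < m%:R :> R by rewrite ltr0n (leq_ltn_trans _ (ltn_ord i)).
have raA : 0 < rho_average (A *m A^T) by rewrite mulr_gt0 ?invr_gt0.
have raAt : 0 < rho_average (A^T *m A) by rewrite mulr_gt0 ?invr_gt0// mxtrace_mulC.
have r0 : 0 < r by rewrite r_def mulr_gt0//; lra.
have s00 : 0 < s0 by rewrite s0_def mulr_gt0// divr_gt0// mulr_gt0.
have sa0 : 0 < sa.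
  by rewrite sa_def mulr_gt0// mulr_gt0 ?divr_gt0//; lra.
have smin0 : 0 < smin.
  by rewrite smin_def mulr_gt0// sqrtr_gt0 divr_gt0// rho_gram_gt0.
have nu0 : 0 < nu by case/andP: nu_bounds.
have s_bnd := apdhg_step_bounds r0 nu0 theta_bound s00 smin0 run.
set lo := Num.min s0 smin in s_bnd; set hi := Num.max _ _ in s_bnd.
have lo0 : 0 < lo by rewrite lt_min s00.
have s_pos k : 0 < s k by case/andP: (s_bnd k) => /(lt_le_trans lo0).
have s_hi k : s k <= hi by case/andP: (s_bnd k).
have hi0 : 0 < hi := lt_le_trans (s_pos 0%N) (s_hi 0%N).
have ystep k : y_step A theta1 theta2 Y (s k) (usubmx (wt k)) (dsubmx (w k))
    (dsubmx (wt k)) by exact: backtrack_y_step (apdhg_y run k).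
pose E z k := sqnormH (HPD r sa) (w k - z).
pose c := gamma * (2 - gamma) / (4 * (2 + hi / sa)).
have c0 : 0 < c.
  have q0 : 0 < hi / sa by rewrite divr_gt0.
  by rewrite /c divr_gt0// ?mulr_gt0//; lra.
pose T k := residual r (s k) (w k - wt k).
have T0 k : 0 <= T k by exact: residual_ge0.
have decr z : Omega_star A theta1 theta2 X Y z ->
    forall k, E z k.+1 <= E z k - c * T k.
  move=> sol k; rewrite /E (apdhg_w run).
  apply: (relaxed_step_decrease (nu := nu)) => //.
  - by rewrite linearB; exact: relaxed.
  - exact/eqP/no_stop.
  - exact: (trial_cross_ge0 theta1_convex theta2_convex X_convex Y_convex
      (apdhg_x run k) (ystep k) sol).
have E0 z k : 0 <= E z k by rewrite /E sqnormH_HPD; exact: residual_ge0.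
have [zs sol] : Omega_star A theta1 theta2 X Y !=set0.
  have [z /saddle_points_Omega_star sol] := saddle_neq0; exact: ex_intro sol.
have cT0 : (fun k => c * T k) @ \oo --> (0 : R).
  apply: (@decrease_cvg0 _ (E zs) _ (E0 zs)) => [k|]; last exact: decr.
  by rewrite mulr_ge0 ?T0// ltW.
have d0 : (fun k => w k - wt k) @ \oo --> (0 : 'cV[R]_(n + m)).
  apply/cvg_sqnormP.
  (* |dx|^2 <= T k / r and |dy|^2 <= T k / lo. *)
  pose K := (r^-1 + lo^-1) / c.
  apply: (@squeeze_cvgr _ _ _ _ (fun=> 0) (fun k => K * (c * T k))).
  - apply: nearW => k; rewrite subr0 sqnorm_ge0 sqnorm_submx /=.
    rewrite /K -mulrA mulKf ?gt_eqF// mulrDl.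
    have x0 := mulr_ge0 (ltW r0) (sqnorm_ge0 (usubmx (w k - wt k))).
    have y0 := mulr_ge0 (ltW (s_pos k)) (sqnorm_ge0 (dsubmx (w k - wt k))).
    apply: lerD; rewrite ler_pdivlMl//; rewrite /T /residual; first by rewrite lerDl.
    apply: (@le_trans _ _ (s k * sqnorm (dsubmx (w k - wt k)))); last by rewrite lerDr.
    by rewrite ler_wpM2r ?sqnorm_ge0//; case/andP: (s_bnd k).
  - exact: cvg_cst.
  - by rewrite -(mulr0 K); apply: cvgM => //; exact: cvg_cst.
apply: (@fejer_cvg _ _ (sqnormH (HPD r sa)) (Num.min r sa) (Num.max r sa)).
- by rewrite lt_min r0.
- move=> v; rewrite sqnormH_HPD sqnorm_submx !mulrDr.
  by apply/andP; split; apply: lerD;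
    rewrite ler_wpM2r ?sqnorm_ge0// ?ge_min ?le_max lexx ?orbT.
- by exists zs.
- move=> z /decr zdecr k; apply: le_trans (zdecr k) _.
  by rewrite gerBl mulr_ge0// ltW.
- move=> f z foo wf.
  apply: (@limit_point_Omega_star _ _ _ _ _ _ _ _ theta1_convex theta2_convex
    X_convex Y_convex X_closed Y_closed r hi (s \o f) (w \o f) (wt \o f)) => //.
  + by move=> k /=; rewrite s_pos s_hi.
  + by move=> k /=; exact: apdhg_x run _.
  + by move=> k; exact: ystep.
  + exact: (cvg_comp _ _ foo d0).
Qed.
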